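(* Let $\mathbb K$ be an algebraically closed field of characteristic $0$ and let $B$ be a diagonalizable square matrix over $\mathbb K$. There exists an infinite sequence of diagonalizable matrices $B=B_1,B_2,\ldots$ over $\mathbb K$ such that $B_{i+1}$ is an integral of $B_i$ for all $i\in\mathbb N$ if and only if there exists an infinite sequence of polynomials $p_B(x)=p_1(x),p_2(x),\ldots$ in $\mathbb K[x]$ such that $p_{i+1}(x)$ is a full integral of $p_i(x)$ for all $i\in\mathbb N$.
   Context: For a square matrix $M$, $p_M(x)=\det(xI-M)$. For $B\in M_n(\mathbb K)$ put $\tau(B)=\frac{1}{n}\mathrm{tr}(B)$. A matrix $A\in M_{n+1}(\mathbb K)$ is an integral of $B\in M_n(\mathbb K)$ if $A=\begin{pmatrix} B & u^{\top}\\ v & \tau(B)\end{pmatrix}$ for some row vectors $u,v\in\mathbb K^n$ and $p_B(x)=\frac{1}{n+1}p_A'(x)$. A polynomial $P\in\mathbb K[x]$ is a full integral of $p\in\mathbb K[x]$ if $P'=p$ and for every $\lambda\in\mathbb K$ with $(x-\lambda)^2\mid p$ one has $(x-\lambda)\mid P$. Here $\mathbb N=\{1,2,\ldots\}$. Diagonalizable means diagonalizable over $\mathbb K$. *)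

(* Defs.v *)
From HB Require Import structures.
From mathcomp Require Import all_boot all_order all_algebra.

Set Implicit Arguments.
Unset Strict Implicit.
Unset Printing Implicit Defensive.

Import GRing.Theory.
Local Open Scope ring_scope.

Definition tau (K : fieldType) (n : nat) (B : 'M[K]_n) : K :=
  n%:R^-1 * \tr B.

(* [block_mx] produces a matrix of size [n + 1]; the cast along [addn1] only
   retypes it at size [n.+1]. *)
Definition is_integral (K : fieldType) (n : nat)
    (A : 'M[K]_n.+1) (B : 'M[K]_n) : Prop :=
  (exists u v : 'rV[K]_n,
     A = castmx (addn1 n, addn1 n) (block_mx B u^T v (tau B)%:M)) /\
  char_poly B = n.+1%:R^-1 *: (char_poly A)^`().

Definition is_full_integral (K : fieldType) (P p : {poly K}) : Prop :=
  P^`() = p /\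
  forall a : K, ('X - a%:P) ^+ 2 %| p -> 'X - a%:P %| P.

(* Main.v *)
Require Import Defs.
From mathcomp Require Import all_boot all_order all_algebra.
From Stdlib Require Import IndefiniteDescription.

(* A multiple eigenvalue of a diagonalizable [B] has an eigenspace of dimension
   at least 2, so it stays an eigenvalue after bordering [B] by one row and one
   column; hence the suitably scaled characteristic polynomials of a sequence
   of integrals are successive full integrals.

   Conversely let [B] be diagonal with entries [d i], and let [P] be a full
   integral of [(n + 1) p_B].  Border [B] by 1 and by weights [w i] in the
   positions [i] with [P(d i) <> 0] (there the [d i] are distinct, by fullness)
   and by 0 elsewhere.  The characteristic polynomial of this arrow matrix is
   [g * f], where [g] is the product of [X - d i] over the zero positions, and
   Lagrange interpolation gives weights for which [g * f = P].  In
   characteristic 0 the order of [P] at each of its roots exceeds that of [P']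
   by one, so [f] has simple roots, which makes the arrow matrix
   diagonalizable. *)

Set Implicit Arguments.
Unset Strict Implicit.
Unset Printing Implicit Defensive.

Import GRing.Theory.
Local Open Scope ring_scope.

(** * Multiplicities of roots *)

Lemma pchar0_natf_neq0 (K : idomainType) (charK0 : [pchar K] =i pred0) (n : nat) :
  n.+1%:R != 0 :> K.
Proof. by have /pcharf0P-> := charK0. Qed.

(** If [p = q * (X - x)^(m+1)], then [p'] is [(X - x)^m] times a factor whose value at [x] is
    [(m+1) q(x)], nonzero in characteristic 0. *)
Lemma mup_deriv (K : fieldType) (charK0 : [pchar K] =i pred0) (p : {poly K})
    (x : K) :
  p != 0 -> root p x -> mup x p = (mup x p^`()).+1.
Proof.
move=> p0 px; have [[|m] [q]] := multiplicity_XsubC p x; rewrite p0 /= => qx pE.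
  by move: px; rewrite pE expr0 mulr1 (negPf qx).
have mupX (r : {poly K}) k : ~~ root r x -> mup x (r * ('X - x%:P) ^+ k) = k.
  by move=> rx; rewrite mupMr // mup_XsubCX eqxx.
have -> : p^`() = (q^`() * ('X - x%:P) + q *+ m.+1) * ('X - x%:P) ^+ m.
  rewrite pE derivM deriv_exp derivXsubC mul1r exprS mulrA /= mulrDl.
  by rewrite mulrnAr mulrnAl.
rewrite pE !mupX // /root !hornerE hornerMn subrr mulr0 add0r -mulr_natr.
by rewrite mulf_neq0 ?pchar0_natf_neq0.
Qed.

Lemma monic_prod_XsubC_closed (K : closedFieldType) (p : {poly K}) :
  p \is monic -> exists rs : seq K, p = \prod_(r <- rs) ('X - r%:P).
Proof.
move=> /monicP p1; have [rs pE] := closed_field_poly_normal p.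
by exists rs; rewrite {1}pE p1 scale1r.
Qed.

Lemma dvdp_mup (K : closedFieldType) (p q : {poly K}) :
  p \is monic -> q \is monic -> (forall x, (mup x p <= mup x q)%N) -> p %| q.
Proof.
move=> /monic_prod_XsubC_closed[s ->] /monic_prod_XsubC_closed[t ->] le_st.
have /count_maskP[m sz_m perm_s] : forall x, (count_mem x s <= count_mem x t)%N.
  by move=> x; rewrite -!mu_prod_XsubC.
rewrite (perm_big _ perm_s) /= {perm_s}.
elim: t m {le_st} sz_m => [|x t IHt] [|b m] //= [sz_m].
by case: b; rewrite !big_cons ?dvdp_mul ?dvdp_mull ?IHt.
Qed.

Lemma uniq_roots_mup (K : closedFieldType) (p : {poly K}) :
  p \is monic -> (forall x, (mup x p <= 1)%N) ->
  exists2 rs : seq K, uniq rs & p = \prod_(r <- rs) ('X - r%:P).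
Proof.
move=> /monic_prod_XsubC_closed[rs ->] le1; exists rs => //.
apply: count_mem_uniq => x; have := le1 x; rewrite mu_prod_XsubC.
by rewrite -has_pred1 has_count; case: (count _ _) => [|[]].
Qed.

(** * Lagrange interpolation at the nodes [d i] *)

Lemma size_prod_XsubC_pred (K : fieldType) (I : finType) (N : pred I) (d : I -> K) :
  size (\prod_(i | N i) ('X - (d i)%:P)) = #|N|.+1.
Proof. by rewrite -big_enum /= size_prod_XsubC -cardE. Qed.

Lemma root_prod_XsubC_pred (K : fieldType) (I : finType) (N : pred I)
    (d : I -> K) (x : K) :
  reflect (exists2 i, N i & x = d i) (root (\prod_(i | N i) ('X - (d i)%:P)) x).
Proof.
rewrite -big_enum /= -(big_map d predT (fun a => 'X - a%:P)) root_prod_XsubC.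
apply: (iffP mapP) => -[i]; last by exists i; rewrite ?mem_enum.
by rewrite mem_enum; exists i.
Qed.

Section Interpolation.

Variables (K : fieldType) (I : finType) (N : pred I) (d : I -> K).
Hypothesis inj_d : {in N &, injective d}.

(** The Lagrange basis polynomial at the node [d i], before normalization by its value there. *)
Definition node_cofactor (i : I) : {poly K} :=
  \prod_(j | N j && (j != i)) ('X - (d j)%:P).

Lemma node_cofactor_neq0 i : N i -> (node_cofactor i).[d i] != 0.
Proof.
move=> Ni; apply/root_prod_XsubC_pred => -[j /andP[Nj neq_ji]] /esym/inj_d.
by move=> /(_ Nj Ni)/eqP; apply/negP.
Qed.

Lemma node_cofactor_eq0 i j : N i -> i != j -> (node_cofactor j).[d i] = 0.
Proof.
by move=> Ni ij; apply/rootP/root_prod_XsubC_pred; exists i; rewrite ?Ni.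
Qed.

Lemma node_cofactorM i : N i ->
  ('X - (d i)%:P) * node_cofactor i = \prod_(j | N j) ('X - (d j)%:P).
Proof. by move=> Ni; rewrite [RHS](bigD1 i). Qed.

Lemma size_node_cofactor i : N i -> size (node_cofactor i) = #|N|.
Proof.
move=> Ni; rewrite size_prod_XsubC_pred [in RHS](cardD1 i) [i \in N]Ni add1n.
by congr _.+1; apply: eq_card => j; rewrite !inE andbC.
Qed.

(** The difference of the two sides has degree below [#|N|] and vanishes at [#|N|] distinct
    nodes. *)
Lemma node_interpolation (f : {poly K}) : (size f <= #|N|)%N ->
  f = \sum_(i | N i) (f.[d i] / (node_cofactor i).[d i]) *: node_cofactor i.
Proof.
move=> szf; apply/eqP; rewrite -subr_eq0; apply/eqP.
apply: (@roots_geq_poly_eq0 _ _ [seq d i | i <- enum N]).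
- apply/allP => _ /mapP[i + ->]; rewrite mem_enum => Ni.
  rewrite /root hornerD hornerN horner_sum (bigD1 i) //= big1 => [|j /andP[Nj ji]].
    by rewrite hornerZ divfK ?node_cofactor_neq0 // addr0 subrr.
  by rewrite hornerZ (node_cofactor_eq0 Ni) ?mulr0 1?eq_sym.
- rewrite map_inj_in_uniq ?enum_uniq // => i j.
  by rewrite !mem_enum; apply: inj_d.
rewrite size_map -cardE (leq_trans (size_polyD _ _)) // geq_max szf size_polyN.
apply/(leq_trans (size_sum _ _ _))/bigmax_leqP => i Ni.
by rewrite (leq_trans (size_scale_leq _ _)) ?size_node_cofactor.
Qed.

End Interpolation.

(** * Arrow matrices *)

(** Dual criterion: every eigenrow lies in the sum [S] of the eigenspaces, so each column of
    [cokermx S] is killed by all of them; once these columns vanish, [S] is the whole space. *)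
Lemma diagonalizable_eigenrows (K : fieldType) (n : nat) (A : 'M[K]_n) (rs : seq K) :
  uniq rs ->
  (forall w : 'cV[K]_n,
     (forall (r : K) (v : 'rV[K]_n), r \in rs -> v *m A = r *: v -> v *m w = 0) ->
     w = 0) ->
  diagonalizable A.
Proof.
move=> Urs sep; apply/diagonalizablePeigen; exists rs => //.
set S := (\sum_(r <- rs) _)%MS.
suff : row_full S by move=> fS; apply/eqmxP; rewrite submx1 sub1mx.
rewrite -cokermx_eq0; apply/eqP/matrixP => i j.
have <- : (col j (cokermx S)) i 0 = cokermx S i j by exact: mxE.
suff : col j (cokermx S) = 0 by move/colP=> ->; rewrite !mxE.
apply: sep => r v r_rs vA; rewrite colE mulmxA.
suff vS : v *m cokermx S == 0 by rewrite (eqP vS) mul0mx.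
rewrite -submxE /S (big_rem r) //=; apply: submx_trans (addsmxSl _ _).
exact/eigenspaceP.
Qed.

Section ArrowMatrix.

Variables (K : fieldType) (n : nat) (N : pred 'I_n) (d w : 'I_n -> K) (t : K).

Definition arrow_mx : 'M[K]_(n + 1) :=
  block_mx (diag_mx (\row_i d i)) (\row_i (N i)%:R)^T (\row_i (w i *+ N i)) t%:M.

Let q : {poly K} := \prod_(i | N i) ('X - (d i)%:P).
(** [c i / q] is [w i / (X - d i)] for [i] in [N], with the denominator cleared. *)
Let c (i : 'I_n) : {poly K} := (w i *: node_cofactor N d i) *+ N i.

(** This is [q] times the secular function [X - t - \sum_(i | N i) w i / (X - d i)]. *)
Definition arrow_poly : {poly K} :=
  ('X - t%:P) * q - \sum_(i | N i) w i *: node_cofactor N d i.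

Let cE i : ('X - (d i)%:P) * c i = (w i *+ N i) *: q.
Proof.
rewrite /c; case Ni: (N i); rewrite ?mulr0n ?mulr0 ?scale0r // !mulr1n.
by rewrite -scalerAr node_cofactorM.
Qed.

Let sum_c : \sum_i c i *+ N i = \sum_(i | N i) w i *: node_cofactor N d i.
Proof. by rewrite [RHS]big_mkcond; apply: eq_bigr => i _; rewrite /c; case: (N i). Qed.

(* Left multiplication by [[1, 0], [c, q]] clears the last row of [X - A] up to
   the corner entry, which becomes the Schur complement [arrow_poly]. *)
Lemma char_poly_arrow :
  char_poly arrow_mx = \prod_(i | ~~ N i) ('X - (d i)%:P) * arrow_poly.
Proof.
have q0 : q != 0 by rewrite monic_neq0 ?monic_prod_XsubC.
have qE : q * \prod_(i | ~~ N i) ('X - (d i)%:P) = \prod_i ('X - (d i)%:P).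
  by rewrite [RHS](bigID N).
apply: (mulfI q0); rewrite mulrA {}qE.
pose D := char_poly_mx (diag_mx (\row_i d i)).
pose u : 'cV[{poly K}]_n := - \col_i (N i)%:R.
have detD : \det D = \prod_i ('X - (d i)%:P).
  rewrite -[LHS]/(char_poly _) char_poly_trig ?diag_mx_is_trig //.
  by apply: eq_bigr => i _; rewrite !mxE eqxx.
pose L : 'M[{poly K}]_(n + 1) := block_mx 1%:M 0 (\row_i c i) q%:M.
have -> : q = \det L by rewrite det_lblock det1 mul1r det_scalar1.
rewrite -det_mulmx -detD -[arrow_poly]det_scalar1 -(det_ublock D u).
congr (\det _).
rewrite /char_poly_mx map_block_mx /= (scalar_mx_block n 1) opp_block_mx.
rewrite add_block_mx !add0r mulmx_block !mul1mx !mul0mx !addr0.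
congr block_mx.
- by apply/colP => i; rewrite !mxE; case: (N i).
- apply/rowP => i; rewrite mxE mul_scalar_mx !mxE (bigD1 i) //= big1.
    rewrite !mxE eqxx !mulr1n addr0 mulrC cE.
    by rewrite mulrN -mul_polyC mulrC subrr.
  by move=> j ji; rewrite !mxE (negPf ji) !mulr0n subrr mulr0.
apply/matrixP => i j; rewrite !ord1 mxE mul_scalar_mx !mxE eqxx !mulr1n.
rewrite addrC /arrow_poly mulrC -sum_c -sumrN; congr (_ + _).
by apply: eq_bigr => k _; rewrite !mxE; case: (N k); rewrite ?mulrN1 ?oppr0 ?mulr0.
Qed.

(* The cofactor row [(c, q)] specializes at a root [r] to an eigenvector. *)
Lemma arrow_eigenrow r : root arrow_poly r ->
  row_mx (\row_i (c i).[r]) q.[r]%:M *m arrow_mx =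
  r *: row_mx (\row_i (c i).[r]) q.[r]%:M.
Proof.
move=> /rootP r0; rewrite mul_row_block scale_row_mx; congr row_mx.
  apply/rowP => i; rewrite mxE mul_mx_diag mul_scalar_mx !mxE.
  have /(congr1 (horner^~ r)) := cE i; rewrite !hornerE [q.[r] * _]mulrC => <-.
  by rewrite mulrBl [_ * d i]mulrC addrC subrK.
apply/matrixP => i j; rewrite !ord1 mxE mul_scalar_mx !mxE eqxx !mulr1n.
move: r0; rewrite /arrow_poly -sum_c !hornerE horner_sum mulrBl => /eqP.
rewrite subr_eq0 => /eqP/(canRL (subrK _)) ->.
rewrite [t * _]mulrC; congr (_ + _); apply: eq_bigr => k _.
by rewrite !mxE !hornerMn mulr_natr.
Qed.

Hypothesis inj_d : {in N &, injective d}.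
Hypothesis w_neq0 : forall i, N i -> w i != 0.
Variable rs : seq K.
Hypotheses (uniq_rs : uniq rs) (arrowE : arrow_poly = \prod_(r <- rs) ('X - r%:P)).
Hypothesis mem_rs : forall i, ~~ N i -> d i \in rs.

Let size_rs : size rs = #|N|.+1.
Proof.
apply/eq_add_S; rewrite -(size_prod_XsubC rs id) -arrowE /arrow_poly.
rewrite size_polyDl size_mul ?polyXsubC_eq0 ?monic_neq0 ?monic_prod_XsubC //.
  by rewrite size_XsubC size_prod_XsubC_pred.
rewrite size_polyN size_XsubC size_prod_XsubC_pred /= ltnS.
apply/(leq_trans (size_sum _ _ _))/bigmax_leqP => i Ni.
by rewrite (leq_trans (size_scale_leq _ _)) ?size_node_cofactor // leqnSn.
Qed.

Lemma diagonalizable_arrow : diagonalizable arrow_mx.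
Proof.
apply: (diagonalizable_eigenrows uniq_rs) => z zP.
(* Outside [N] the coordinate row is itself an eigenrow, for the eigenvalue [d i], which lies in
   [rs]. *)
have zN i : ~~ N i -> z (lshift 1 i) 0 = 0.
  move=> Ni; have := zP (d i) (row_mx (delta_mx 0 i) 0) (mem_rs Ni).
  rewrite -[z]vsubmxK mul_row_block mul_row_col !mul0mx !addr0 -!rowE.
  rewrite row_diag_mx mxE scale_row_mx scaler0.
  have -> : row i (\row_j (N j)%:R)^T = 0 :> 'M[K]_1.
    by apply/rowP => j; rewrite !mxE (negPf Ni).
  by move=> /(_ erefl)/matrixP/(_ 0 0); rewrite vsubmxK !mxE.
(* The value of [f] at [r] is the pairing of [z] with the cofactor eigenrow at [r]. It vanishes at
   the [#|N| + 1] distinct roots, while [f] has degree at most [#|N|]. *)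
pose f := \sum_i z (lshift 1 i) 0 *: c i + z (rshift n 0) 0 *: q.
have f0 : f = 0.
  apply: (@roots_geq_poly_eq0 _ _ rs) => //.
    apply/allP => r r_rs.
    have root_r : root arrow_poly r by rewrite arrowE root_prod_XsubC.
    have := zP _ _ r_rs (arrow_eigenrow root_r).
    rewrite -[z]vsubmxK mul_row_col => /matrixP/(_ 0 0).
    rewrite mul_scalar_mx !mxE => E; apply/rootP; rewrite -[RHS]E /f.
    rewrite !hornerE horner_sum; congr (_ + _); last by rewrite mulrC.
    by apply: eq_bigr => i _; rewrite !mxE hornerZ mulrC.
  rewrite size_rs (leq_trans (size_polyD _ _)) // geq_max; apply/andP; split.
    apply/(leq_trans (size_sum _ _ _))/bigmax_leqP => i _.
    rewrite (leq_trans (size_scale_leq _ _)) // /c; case Ni: (N i).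
      by rewrite mulr1n (leq_trans (size_scale_leq _ _)) ?size_node_cofactor.
    by rewrite mulr0n size_poly0.
  by rewrite (leq_trans (size_scale_leq _ _)) // size_prod_XsubC_pred.
(* At a node [d i] only the [i]-th term of [f] survives, and its coefficient is nonzero because
   [w i] is. *)
have zu i : z (lshift 1 i) 0 = 0.
  case Ni: (N i); last by rewrite zN ?Ni.
  have /eqP := congr1 (horner^~ (d i)) f0; rewrite /f !hornerE horner_sum.
  rewrite (bigD1 i) //= big1 => [|j ji]; last first.
    rewrite hornerZ /c hornerMn hornerZ; case Nj: (N j).
      by rewrite node_cofactor_eq0 1?eq_sym // !mulr0.
    by rewrite mulr0.
  have /rootP-> : root q (d i) by apply/root_prod_XsubC_pred; exists i.
  rewrite mulr0 !addr0 hornerZ /c Ni hornerZ !mulf_eq0 (negPf (w_neq0 _)) //.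
  by rewrite (negPf (node_cofactor_neq0 _ _)) // !orbF => /eqP.
have /eqP : z (rshift n 0) 0 *: q = 0.
  by rewrite -[RHS]f0 /f big1 ?add0r // => i _; rewrite zu scale0r.
rewrite scaler_eq0 [q == 0](negPf _) ?monic_neq0 ?monic_prod_XsubC // orbF => /eqP zd.
rewrite -[z]vsubmxK -[RHS]vsubmxK; congr col_mx; apply/matrixP => i j.
  by rewrite !ord1 !mxE zu.
by rewrite !ord1 !mxE zd.
Qed.

End ArrowMatrix.

(** * Primitives of a monic polynomial *)

(** The two top coefficients of [p] are forced by [q]. For [q] the product of the [X - d i], the
    linear factor is [X - t] with [t] the mean of the [d i], which is why the corner entry [tau] is
    the right one. *)
Lemma size_primitive_sub (K : fieldType) (charK0 : [pchar K] =i pred0)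
    (n : nat) (n_gt0 : (0 < n)%N) (p q : {poly K}) :
  q \is monic -> size q = n.+1 -> p^`() = n.+1%:R *: q ->
  (size (p - ('X + (n%:R^-1 * q`_n.-1)%:P) * q)%R <= n)%N.
Proof.
move=> /monicP lc_q sz_q p'E; apply/leq_sizeP => j le_nj.
have j_gt0 := leq_trans n_gt0 le_nj; rewrite -(prednK j_gt0) in le_nj *.
move: j.-1 le_nj => {j_gt0}j le_nj.
(* Multiplying by [j + 1] turns the coefficient of [X^(j+1)] in [p] into a coefficient of [p']. *)
apply: (mulIf (pchar0_natf_neq0 charK0 j)); rewrite mul0r.
rewrite coefB [(_ + _) * q]mulrDl coefD coefXM /= coefCM mulrBl.
rewrite mulr_natr -coef_deriv p'E coefZ.
have sz0 k : (n < k)%N -> q`_k = 0 by move=> ?; rewrite nth_default ?sz_q.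
have [lt_nj|le_jn] := ltnP n j.
  by rewrite (sz0 j) // (sz0 j.+1) ?leqW // !(mulr0, mul0r, addr0, subr0).
move: le_nj; rewrite leq_eqVlt => /orP[/eqP nE|lt_nj].
  have qn : q`_n = 1 by rewrite -lc_q lead_coefE sz_q.
  have n0 : n%:R != 0 :> K by rewrite nE pchar0_natf_neq0.
  rewrite -nE qn mulr1 mulrDl -[j]/(j.+1.-1) -nE mulrAC mulVf // mul1r.
  by rewrite -[n.+1%:R]natr1 mulrDl mul1r mulrC subrr.
have -> : j = n by apply/eqP; rewrite eqn_leq le_jn.
by rewrite sz0 // mulr0 addr0 mulrC subrr.
Qed.

Lemma monic_primitive (K : fieldType) (charK0 : [pchar K] =i pred0)
    (n : nat) (n_gt0 : (0 < n)%N) (p q : {poly K}) :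
  q \is monic -> size q = n.+1 -> p^`() = n.+1%:R *: q -> p \is monic.
Proof.
move=> mon_q sz_q p'E; have := size_primitive_sub charK0 n_gt0 mon_q sz_q p'E.
set l := 'X + _; set f := p - _ => sz_f.
have mon_l : l \is monic by rewrite /l -[_%:P]opprK -polyCN monicXsubC.
have sz_lq : size (l * q) = n.+2.
  rewrite size_Mmonic ?monic_neq0 // sz_q /l -[_%:P]opprK -polyCN size_XsubC.
  by rewrite addnS.
have -> : p = l * q + f by rewrite /f addrC subrK.
by rewrite monicE lead_coefDl ?sz_lq ?ltnS ?(leq_trans sz_f) // -monicE monicMr.
Qed.

(* The order of [p] at each of its roots exceeds that of [p'] by one, so
   dividing [p] by the common factors [X - d i] leaves simple roots only. *)
Lemma primitive_factor (K : closedFieldType) (charK0 : [pchar K] =i pred0)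
    (n : nat) (d : 'I_n -> K) (p : {poly K}) (N := fun i => ~~ root p (d i)) :
  p \is monic -> p^`() = n.+1%:R *: \prod_i ('X - (d i)%:P) ->
  exists f : {poly K}, exists rs : seq K,
    [/\ p = f * \prod_(i | ~~ N i) ('X - (d i)%:P),
        uniq rs, f = \prod_(r <- rs) ('X - r%:P) &
        forall i, ~~ N i -> d i \in rs].
Proof.
move=> mon_p p'E; have p0 := monic_neq0 mon_p.
pose g := \prod_(i | ~~ N i) ('X - (d i)%:P).
pose q := \prod_(i | N i) ('X - (d i)%:P).
have mon_g : g \is monic by apply: monic_prod_XsubC.
have mon_q : q \is monic by apply: monic_prod_XsubC.
(* Any [d i] equal to a root of [p] has its index outside [N], so the order of [p'] there is that of
   [g] alone. *)
have mup_g x : root p x -> mup x p = (mup x g).+1.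
  move=> px; rewrite mup_deriv // p'E -mul_polyC mupMr; last first.
    by rewrite rootC pchar0_natf_neq0.
  rewrite (bigID N) /= mupMr //; apply/root_prod_XsubC_pred => -[i Ni xi].
  by move: Ni; rewrite /N -xi px.
have g_dvd : g %| p.
  apply: dvdp_mup => // x; case px: (root p x); first by rewrite mup_g.
  rewrite [mup x g]mupNroot //; apply/root_prod_XsubC_pred => -[i Ni xi].
  by move: Ni; rewrite /N negbK -xi px.
have /dvdpP[f pE] := g_dvd.
have mon_f : f \is monic by rewrite -(monicMr _ mon_g) -pE.
have mup_f x : root p x -> mup x f = 1%N.
  move=> px; apply/eqP; rewrite -(eqn_add2r (mup x g)).
  by rewrite -mupM ?monic_neq0 // -pE mup_g.
have [|rs Urs fE] := uniq_roots_mup mon_f.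
  move=> x; case px: (root p x); first by rewrite mup_f.
  by rewrite mupNroot //; apply: contraFN px; rewrite pE rootM => ->.
exists f, rs; split => // i; rewrite /N negbK => /mup_f.
by rewrite -root_prod_XsubC -fE -dvdp_XsubCl XsubC_dvd ?monic_neq0 // => ->.
Qed.

(** * Construction of integrals *)

Lemma exists_arrow_integral (K : closedFieldType) (charK0 : [pchar K] =i pred0)
    (n : nat) (n_gt0 : (0 < n)%N) (d : 'I_n -> K) (p : {poly K}) :
  p^`() = n.+1%:R *: \prod_i ('X - (d i)%:P) ->
  (forall i j, i != j -> d i = d j -> root p (d i)) ->
  exists u v : 'rV[K]_n,
    let A := block_mx (diag_mx (\row_i d i)) u^T v (n%:R^-1 * \sum_i d i)%:M in
    diagonalizable A /\ char_poly A = p.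
Proof.
move=> p'E full; pose t := n%:R^-1 * \sum_i d i; pose N i := ~~ root p (d i).
pose D := \prod_i ('X - (d i)%:P).
have mon_D : D \is monic by apply: monic_prod_XsubC.
have sz_D : size D = n.+1 by rewrite size_prod_XsubC_pred card_ord.
have mon_p := monic_primitive charK0 n_gt0 mon_D sz_D p'E.
have [f [rs [pE Urs fE mem_rs]]] := primitive_factor charK0 mon_p p'E.
have inj_d : {in N &, injective d}.
  move=> i j Ni _ dij; apply/eqP; apply: contraT => ij.
  by move: Ni; rewrite unfold_in /N (full i j).
have tE : ('X + (n%:R^-1 * D`_n.-1)%:P) = 'X - t%:P.
  rewrite -polyCN -mulrN; congr ('X + (_ * _)%:P).
  have := @coefPn_prod_XsubC _ [seq d i | i <- enum 'I_n].
  rewrite size_map size_enum_ord -lt0n => /(_ n_gt0).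
  by rewrite !big_map -enumT !big_enum.
have := size_primitive_sub charK0 n_gt0 mon_D sz_D p'E; rewrite tE.
pose g := \prod_(i | ~~ N i) ('X - (d i)%:P).
pose q := \prod_(i | N i) ('X - (d i)%:P).
have mon_g : g \is monic by apply: monic_prod_XsubC.
have -> : p - ('X - t%:P) * D = (f - ('X - t%:P) * q) * g.
  by rewrite [RHS]mulrBl -mulrA -[f * g]pE /D (bigID N).
(* Dividing the degree bound by [g] leaves [h] of degree below [#|N|], so its values at the nodes in
   [N] determine it. *)
set h := f - _ => sz_hg; have sz_h : (size h <= #|N|)%N.
  have [->|h0] := eqVneq h 0; first by rewrite size_poly0.
  move: sz_hg; rewrite size_Mmonic // size_prod_XsubC_pred addnS /= => sz_hg.
  rewrite -(leq_add2r #|[predC N]|) cardC card_ord; exact: sz_hg.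
(* The weights are minus the Lagrange coefficients of [h], so that [arrow_poly] becomes
   [('X - t%:P) * q + h = f]. *)
pose w i := - (h.[d i] / (node_cofactor N d i).[d i]).
have arrowE : arrow_poly N d w t = f.
  rewrite /arrow_poly -/q -[RHS](subrK (('X - t%:P) * q)) -/h.
  rewrite addrC; congr (_ + _); rewrite -sumrN [RHS](node_interpolation inj_d) //.
  by apply: eq_bigr => i _; rewrite scaleNr opprK.
exists (\row_i (N i)%:R), (\row_i (w i *+ N i)); rewrite -/t -/(arrow_mx N d w t).
split; last by rewrite char_poly_arrow arrowE mulrC [RHS]pE.
apply: (diagonalizable_arrow inj_d _ Urs) => [i Ni||//]; last by rewrite arrowE.
(* Since [q] vanishes at [d i], [h] agrees there with [f], which is nonzero because [d i] is not a
   root of [p]. *)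
rewrite oppr_eq0 mulf_neq0 ?invr_neq0 ?node_cofactor_neq0 //.
rewrite /h hornerD hornerN hornerM.
have /rootP-> : root q (d i) by apply/root_prod_XsubC_pred; exists i.
rewrite mulr0 subr0; apply: contraNneq Ni => fi.
by rewrite pE rootM /root fi eqxx.
Qed.

Lemma char_poly_conj (K : fieldType) (n : nat) (V A : 'M[K]_n) :
  V \in unitmx -> char_poly (conjmx V A) = char_poly A.
Proof.
move=> uV; rewrite conjumx // /char_poly /char_poly_mx.
pose VX := map_mx polyC V; pose iVX := map_mx polyC (invmx V).
have VK : VX *m iVX = 1%:M by rewrite -map_mxM mulmxV // map_mx1.
have -> : 'X%:M - map_mx polyC (V *m A *m invmx V) =
    VX *m ('X%:M - map_mx polyC A) *m iVX.
  by rewrite mulmxBr mulmxBl scalar_mxC -['X%:M *m _ *m _]mulmxA VK mulmx1 !map_mxM.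
by rewrite !det_mulmx mulrAC -det_mulmx VK det1 mul1r.
Qed.

Lemma diagonalizable_conj (K : fieldType) (n : nat) (V A : 'M[K]_n) :
  V \in unitmx -> diagonalizable A -> diagonalizable (conjmx V A).
Proof.
move=> uV [P uP PA]; exists (P *m invmx V).
  by rewrite unitmx_mul uP unitmx_inv.
by rewrite /similar_to conjuMumx ?unitmx_inv // conjmxK.
Qed.

Lemma diagonalizable_cast (K : fieldType) (m n : nat) (e : m = n) (A : 'M[K]_m) :
  diagonalizable A -> diagonalizable (castmx (e, e) A).
Proof. by case: n / e. Qed.

Lemma char_poly_cast (K : fieldType) (m n : nat) (e : m = n) (A : 'M[K]_m) :
  char_poly (castmx (e, e) A) = char_poly A.
Proof. by case: n / e. Qed.

(** Reduction to the diagonal case: conjugating by the block matrix of [V] and 1 turns a bordering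
    of [D] into one of [B] with the same corner, and the trace is invariant. *)
Lemma exists_integral (K : closedFieldType) (charK0 : [pchar K] =i pred0)
    (n : nat) (n_gt0 : (0 < n)%N) (B : 'M[K]_n) (p : {poly K}) :
  diagonalizable B -> p^`() = n.+1%:R *: char_poly B ->
  (forall a, ('X - a%:P) ^+ 2 %| char_poly B -> root p a) ->
  exists A : 'M[K]_n.+1, [/\ diagonalizable A, is_integral A B & char_poly A = p].
Proof.
case=> V uV /(similar_diagLR uV)[D BE] p'E full.
pose d i := D 0 i.
have DE : D = \row_i d i by apply/rowP => i; rewrite mxE.
have uVi : invmx V \in unitmx by rewrite unitmx_inv.
have charB : char_poly B = \prod_i ('X - (d i)%:P).
  rewrite BE char_poly_conj // char_poly_trig ?diag_mx_is_trig //.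
  by apply: eq_bigr => i _; rewrite !mxE eqxx.
have trB : \tr B = \sum_i d i.
  by rewrite BE conjVmx // mxtrace_mulC mulKVmx // mxtrace_diag.
have [|i j ij dij|u [v [diagA charA]]] :=
    @exists_arrow_integral K charK0 n n_gt0 d p; first by rewrite -charB.
  apply: full; rewrite charB (bigD1 i) // (bigD1 j) 1?eq_sym //= -dij mulrA -expr2.
  exact: dvdp_mulr.
set A := block_mx _ _ _ _ in diagA charA.
pose W : 'M[K]_(n + 1) := block_mx V 0 0 1%:M.
have uW : W \in unitmx.
  by rewrite unitmxE det_ublock det1 mulr1 -unitmxE.
have WiE : invmx W = block_mx (invmx V) 0 0 1%:M.
  rewrite -[LHS]mulmx1; apply: (canLR (mulKmx uW)).
  rewrite mulmx_block !(mulmx0, mul0mx, mulmx1, addr0, add0r) mulmxV //.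
  by rewrite -scalar_mx_block.
exists (castmx (addn1 n, addn1 n) (conjmx (invmx W) A)); split.
- by apply/diagonalizable_cast/diagonalizable_conj; rewrite ?unitmx_inv.
- split; last first.
    rewrite char_poly_cast char_poly_conj ?unitmx_inv // charA p'E scalerA.
    by rewrite mulVf ?scale1r // pchar0_natf_neq0.
  exists (invmx V *m u^T)^T, (v *m V); congr castmx.
  rewrite conjVmx // WiE !mulmx_block.
  rewrite !(mulmx0, mul0mx, mulmx1, mul1mx, addr0, add0r) trmxK -DE.
  by rewrite /tau trB BE conjVmx.
by rewrite char_poly_cast char_poly_conj ?unitmx_inv.
Qed.

(* The eigenspace of a multiple eigenvalue [a] of [B] meets the hyperplane
   orthogonal to [u], and such a vector extended by 0 is an eigenvector of the
   bordered matrix. *)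
Lemma root_char_poly_border (K : fieldType) (n : nat) (B : 'M[K]_n)
    (u v : 'rV[K]_n) (t a : K) :
  diagonalizable B -> ('X - a%:P) ^+ 2 %| char_poly B ->
  root (char_poly (block_mx B u^T v t%:M)) a.
Proof.
case=> V uV /similar_diagPex[D /(similarP uV) VB].
have -> : char_poly B = \prod_i ('X - (D 0 i)%:P).
  rewrite -(char_poly_conj _ uV) conjumx // VB mulmxK //.
  rewrite char_poly_trig ?diag_mx_is_trig //.
  by apply: eq_bigr => i _; rewrite !mxE eqxx.
rewrite expr2 => a2_dvd.
have /root_prod_XsubC_pred[i _ aE] : root (\prod_i ('X - (D 0 i)%:P)) a.
  by rewrite -dvdp_XsubCl; apply: dvdp_trans a2_dvd; apply: dvdp_mulr.
move: a2_dvd; rewrite (bigD1 i) //= -aE dvdp_mul2l ?polyXsubC_eq0 // dvdp_XsubCl.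
case/root_prod_XsubC_pred=> j ji aE'.
pose s k := (row k V *m u^T) 0 0.
(* A nonzero solution of [al * s i + be * s j = 0]: the pair [(- s j, s i)], or [(1, 0)] when
   [s i = 0]. *)
pose al := if s i == 0 then 1 else - s j; pose be := if s i == 0 then 0 else s i.
pose x : 'rV[K]_n := al *: delta_mx 0 i + be *: delta_mx 0 j.
have x0 : x != 0.
  apply/negP => /eqP/rowP x0; have := x0 i; have := x0 j.
  rewrite !mxE !eqxx (negPf ji) eq_sym (negPf ji) !mulr0 !mulr1 addr0 add0r /al /be.
  by case: eqP => // _ _ /eqP; rewrite oner_eq0.
have xD : x *m diag_mx D = a *: x.
  rewrite mulmxDl -!scalemxAl -!rowE !row_diag_mx -aE -aE' scalerDr.
  by rewrite !scalerA ![_ * a]mulrC.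
have xu : x *m V *m u^T = 0.
  rewrite mulmxDl -!scalemxAl -!rowE mulmxDl -!scalemxAl.
  apply/matrixP => k l; rewrite !ord1 mxE [in LHS]mxE [X in _ + X]mxE -/(s i) -/(s j).
  rewrite [RHS]mxE /al /be; case: eqP => [->|_].
    by rewrite mulr0 mul0r addr0.
  by rewrite mulNr mulrC addNr.
rewrite -eigenvalue_root_char; apply/eigenvalueP.
exists (row_mx (x *m V) 0).
  rewrite mul_row_block !mul0mx !addr0 xu -mulmxA VB mulmxA xD.
  by rewrite scale_row_mx scaler0 scalemxAl.
apply: contraNneq x0 => /eqP; rewrite row_mx_eq0 => /andP[/eqP xV _].
by rewrite -(mulmxK uV x) xV mul0mx.
Qed.

(* The sequences are indexed from 0.  An integral has one more row and column
   than the given matrix, so the i-th matrix has size i + n; the order of the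
   summands makes 0 + n and i.+1 + n convertible to n and (i + n).+1. *)
Theorem corollary4p3 (K : closedFieldType) (charK0 : [pchar K] =i pred0)
    (n : nat) (n_gt0 : (0 < n)%N) (B : 'M[K]_n) (diagB : diagonalizable B) :
  (exists Bs : forall i : nat, 'M[K]_(i + n),
     [/\ Bs 0%N = B,
         forall i : nat, diagonalizable (Bs i) &
         forall i : nat, is_integral (Bs i.+1) (Bs i)])
  <->
  (exists p : nat -> {poly K},
     p 0%N = char_poly B /\
     forall i : nat, is_full_integral (p i.+1) (p i)).
Proof.
split=> [[Bs [Bs0 diagBs intBs]]|[p [p0 full_p]]].
  (* The scalar is [n! / (n + i)!]; it absorbs the factor [1 / (i + n + 1)] that each integral
     introduces. *)
  pose c i : K := \prod_(j < i) (j + n).+1%:R^-1.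
  exists (fun i => c i *: char_poly (Bs i)); split.
    by rewrite /c big_ord0 scale1r Bs0.
  move=> i; have [[u [v BsE]] charBs] := intBs i; split.
    by rewrite derivZ charBs scalerA /c big_ord_recr.
  have c0 k : c k != 0.
    by apply/prodf_neq0 => j _; rewrite invr_eq0 pchar0_natf_neq0.
  move=> a; rewrite !dvdpZr // BsE char_poly_cast dvdp_XsubCl => a2_dvd.
  exact: root_char_poly_border.
(* The given polynomials need not be monic, so they are matched to characteristic polynomials only
   up to a nonzero scalar. *)
pose good i (A : 'M[K]_(i + n)) :=
  diagonalizable A /\ exists2 c : K, c != 0 & p i = c *: char_poly A.
have step i (A : {A | good i A}) : exists A' : {A | good i.+1 A},
    is_integral (sval A') (sval A).
  case: A => A [diagA [c c0 pE]] /=; have [p'E mult_p] := full_p i.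
  have in_gt0 : (0 < i + n)%N by rewrite addn_gt0 n_gt0 orbT.
  (* This scaling makes the derivative of [e *: p i.+1] equal to [(i + n).+1%:R *: char_poly A]. *)
  pose e : K := (i + n).+1%:R / c.
  have e0 : e != 0 by rewrite mulf_neq0 ?invr_neq0 ?pchar0_natf_neq0.
  have [||A' [diagA' intA' charA']] :=
      @exists_integral K charK0 _ in_gt0 A (e *: p i.+1) diagA.
  - by rewrite derivZ p'E pE scalerA divfK.
  - move=> a a2_dvd; rewrite rootZ // -dvdp_XsubCl.
    by apply: mult_p; rewrite pE dvdpZr.
  suff good' : good i.+1 A' by exists (exist _ A' good').
  split=> //; exists e^-1; rewrite ?invr_eq0 //.
  by rewrite [char_poly _]charA' scalerA mulVf // scale1r.
have good0 : good 0%N B.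
  by split=> //; exists 1; rewrite ?oner_eq0 // scale1r.
(* Dependent choice: the recursion runs over matrices paired with a proof of [good], so each one
   admits a next integral. *)
pose next i A := constructive_indefinite_description _ (step i A).
pose Bs := nat_rect (fun i => {A | good i A}) (exist _ B good0)
  (fun i A => sval (next i A)).
exists (fun i => sval (Bs i)); split=> // i; first by case: (svalP (Bs i)).
exact: svalP (next i (Bs i)).
Qed.
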